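(* Let $A_1,\dots,A_I$ be subsets of Euclidean spaces $\mathbb{R}^{n_1},\dots,\mathbb{R}^{n_I}$, let $(z_1,\dots,z_I)\in A_1\times\cdots\times A_I$ and let $(d_1,\dots,d_I)\in\mathbb{R}^{n_1}\times\cdots\times\mathbb{R}^{n_I}$ be given. Then $$T_{A_1\times\cdots\times A_I}(z_1,\dots,z_I)\subseteq T_{A_1}(z_1)\times\cdots\times T_{A_I}(z_I),$$ $$N_{A_1\times\cdots\times A_I}\big((z_1,\dots,z_I);(d_1,\dots,d_I)\big)\subseteq N_{A_1}(z_1;d_1)\times\cdots\times N_{A_I}(z_I;d_I),$$ and equality holds (in both inclusions) if all except at most one of the sets $A_i$, $i=1,\dots,I$, are directionally regular at $z_i$.
   Context: For $C\subseteq\mathbb{R}^n$ and $z\in C$: $T_C(z)=\{u:\exists t_k\downarrow 0,\ u_k\to u \text{ with } z+t_ku_k\in C\ \forall k\}$ ($t_k\downarrow0$ means $t_k>0$, $t_k\to0$). The regular (Fréchet) normal cone is $\widehat N_C(z)=\{v:\langle v,z'-z\rangle\le o(\|z'-z\|)\ \forall z'\in C\}$ for $z\in C$, and $\widehat N_C(z)=\emptyset$ for $z\notin C$. The directional limiting normal cone is $N_C(z;d)=\{v:\exists t_k\downarrow0,\ d_k\to d,\ v_k\to v\text{ with }v_k\in\widehat N_C(z+t_kd_k)\ \forall k\}$, and the inner directional limiting normal cone is $N^i_C(z;d)=\{v:\forall t_k\downarrow0\ \exists d_k\to d,\ v_k\to v\text{ with }v_k\in\widehat N_C(z+t_kd_k)\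 \forall k\}$. $C$ is directionally regular at $z$ if $N_C(z;d)=N_C^i(z;d)$ for all $d\in\mathbb{R}^n$. *)

(* Defs.v *)
From HB Require Import structures.
From mathcomp Require Import all_boot all_order all_algebra.
From mathcomp Require Import all_classical all_reals all_analysis.

Set Implicit Arguments.
Unset Strict Implicit.
Unset Printing Implicit Defensive.

Import Order.TTheory GRing.Theory Num.Theory.
Import numFieldNormedType.Exports.

Local Open Scope classical_set_scope.
Local Open Scope ring_scope.

Section DirectionalCones.
Context {R : realType}.

Definition dotprod {n : nat} (u v : 'rV[R]_n) : R := \sum_j u 0 j * v 0 j.

(* The norm of the library on 'rV[R]_n is the sup norm.  The codomain is R^o
   because Landau notations expect a normed module over R. *)
Definition enorm {n : nat} (u : 'rV[R]_n) : R^o := Num.sqrt (dotprod u u).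

(* t_k \downarrow 0; monotonicity is not required. *)
Definition pos_cvg0 (t : nat -> R) : Prop :=
  (forall k, 0 < t k) /\ t @ \oo --> (0 : R).

Definition tangent_cone {n : nat} (C : set 'rV[R]_n) (z : 'rV[R]_n) :
    set 'rV[R]_n :=
  [set u | exists (t : nat -> R) (u_ : nat -> 'rV[R]_n),
     [/\ pos_cvg0 t, u_ @ \oo --> u & forall k, C (z + t k *: u_ k)]].

(* Empty for z outside C.  The term o(|z' - z|) is a function r of z' which is
   negligible with respect to |z' - z| as z' tends to z. *)
Definition regular_normal_cone {n : nat} (C : set 'rV[R]_n) (z : 'rV[R]_n) :
    set 'rV[R]_n :=
  [set v | C z /\
     exists r : 'rV[R]_n -> R^o,
       r =o_z (fun z' => enorm (z' - z)) /\
       forall z', C z' -> dotprod v (z' - z) <= r z'].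

Definition dir_normal_cone {n : nat} (C : set 'rV[R]_n) (z d : 'rV[R]_n) :
    set 'rV[R]_n :=
  [set v | exists (t : nat -> R) (d_ v_ : nat -> 'rV[R]_n),
     [/\ pos_cvg0 t, d_ @ \oo --> d, v_ @ \oo --> v &
         forall k, regular_normal_cone C (z + t k *: d_ k) (v_ k)]].

Definition inner_dir_normal_cone {n : nat} (C : set 'rV[R]_n)
    (z d : 'rV[R]_n) : set 'rV[R]_n :=
  [set v | forall t : nat -> R, pos_cvg0 t ->
     exists d_ v_ : nat -> 'rV[R]_n,
     [/\ d_ @ \oo --> d, v_ @ \oo --> v &
         forall k, regular_normal_cone C (z + t k *: d_ k) (v_ k)]].

Definition dir_regular {n : nat} (C : set 'rV[R]_n) (z : 'rV[R]_n) : Prop :=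
  forall d, dir_normal_cone C z d = inner_dir_normal_cone C z d.

(* R^{n_1} x ... x R^{n_I} is realized as R^{n_1 + ... + n_I}: the tuple
   (x_1, ..., x_I) is the concatenation \mxrow_i x_i, and submxrow x i is the
   i-th block of x. *)
Definition set_mxrow {I : nat} {n : 'I_I -> nat}
    (A : forall i, set 'rV[R]_(n i)) : set 'rV[R]_(\sum_i n i) :=
  [set x | forall i, A i (submxrow x i)].

End DirectionalCones.

(* Main.v *)
Require Import Defs.
From HB Require Import structures.
From mathcomp Require Import all_boot all_order all_algebra.
From mathcomp Require Import all_classical all_reals all_analysis.

Import Order.TTheory GRing.Theory Num.Theory.
Import numFieldNormedType.Exports.

Local Open Scope classical_set_scope.
Local Open Scope ring_scope.

(** The regular normal cone of a product is the product of the regular normal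
    cones, so blocks of sequences realizing a directional normal of the product
    realize directional normals of the factors.  Conversely, factors can be
    glued as soon as their sequences share the same scales [t_k]; a
    directionally regular factor accepts any scales, so they can be dictated
    by the only factor which may fail to be regular.  Since the regular normal
    cone at a point of the set contains 0, [u] is tangent to [C] at [z] iff 0
    is a normal to [C] at [z] in direction [u], which reduces the statement on
    tangent cones to the one on normal cones. *)

Set Implicit Arguments.
Unset Strict Implicit.

Section Blocks.
Context {R : realType} {I : nat} {n : 'I_I -> nat}.
Implicit Types x y : 'rV[R]_(\sum_i n i).

Lemma submxrowZ a x i : submxrow (a *: x) i = a *: submxrow x i.
Proof. by apply/matrixP => j k; rewrite !mxE. Qed.

Lemma dotprod_submxrow x y :
  dotprod x y = \sum_i dotprod (submxrow x i) (submxrow y i).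
Proof.
have dotE m (u v : 'rV[R]_m) : dotprod u v = (u *m v^T) 0 0.
  by rewrite mxE; apply: eq_bigr => j _; rewrite mxE.
rewrite dotE -[x in LHS]submxrowK -[y^T]submxcolK mul_mxrow_mxcol summxE.
by apply: eq_bigr => i _; rewrite dotE tr_submxrow.
Qed.

Lemma dotprod_ge0 m (u : 'rV[R]_m) : 0 <= dotprod u u.
Proof. by apply: sumr_ge0 => j _; rewrite -expr2 sqr_ge0. Qed.

Lemma enorm_ge0 m (u : 'rV[R]_m) : 0 <= enorm u.
Proof. exact: sqrtr_ge0. Qed.

Lemma enorm_submxrow x i : enorm (submxrow x i) <= enorm x.
Proof.
apply: ler_wsqrtr; rewrite [leRHS]dotprod_submxrow (bigD1 i)//= lerDl.
by apply: sumr_ge0 => j _; exact: dotprod_ge0.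
Qed.

Lemma cvg_row m (T : Type) (F : set_system T) {FF : Filter F}
    (f : T -> 'rV[R]_m) (l : 'rV[R]_m) :
  (forall j, f x 0 j @[x --> F] --> l 0 j) -> f @ F --> l.
Proof.
(* A neighbourhood of a matrix contains a product of entrywise neighbourhoods [P]; as there are
   finitely many entries, the filter meets them all at once. *)
move=> fl A [P lP PA].
have := filter_forall FF (fun j => fl j _ (lP 0 j)).
by apply: filterS => x Px; apply: PA => i j; rewrite ord1; exact: Px.
Qed.

Lemma cvg_submxrow (T : Type) (F : set_system T) {FF : Filter F}
    (f : T -> 'rV[R]_(\sum_i n i)) x i :
  f @ F --> x -> submxrow (f y) i @[y --> F] --> submxrow x i.
Proof.
move=> fx; apply: cvg_row => j; rewrite mxE.
under eq_fun do rewrite mxE.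
exact: (cvg_comp f (fun M : 'rV_ _ => M 0 (tagnat.Rank i j)) fx
  (@coord_continuous R 1 _ 0 _ x)).
Qed.

Lemma cvg_mxrow (T : Type) (F : set_system T) {FF : Filter F}
    (f : forall i, T -> 'rV[R]_(n i)) (l : forall i, 'rV[R]_(n i)) :
  (forall i, f i @ F --> l i) -> \mxrow_i f i y @[y --> F] --> \mxrow_i l i.
Proof.
move=> fl; apply: cvg_row => j; rewrite mxE.
under eq_fun do rewrite mxE.
set i := tagnat.sig1 j; set k := tagnat.sig2 j.
exact: (cvg_comp (f i) (fun M : 'rV_ _ => M 0 k) (fl i)
  (@coord_continuous R 1 _ 0 k (l i))).
Qed.

End Blocks.

Section Cones.
Context {R : realType}.

Lemma regular_normal_coneP m (C : set 'rV[R]_m) z v :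
  regular_normal_cone C z v <->
  C z /\ forall e, 0 < e -> \forall y \near z,
    C y -> dotprod v (y - z) <= e * enorm (y - z).
Proof.
split=> -[Cz].
  case=> r [/eqoP ro vr]; split=> // e e0.
  have := ro e e0; apply: filterS => y /= ry Cy.
  apply: le_trans (vr _ Cy) (le_trans (ler_norm _) _).
  by move: ry; rewrite (ger0_norm (enorm_ge0 _)).
move=> vo; split=> //.
(* The estimate is one-sided and holds only on [C], whereas a remainder must be small in absolute
   value at every point near [z]: take the positive part of the inner product on [C] and 0
   elsewhere. *)
exists (fun y => if `[< C y >] then Num.max 0 (dotprod v (y - z)) else 0).
split; last first.
  by move=> y Cy; rewrite asboolT// le_max lexx orbT.
apply/eqoP => e e0; have := vo e e0; apply: filterS => y /= vy.
have en0 : 0 <= e * enorm (y - z) by rewrite mulr_ge0 ?enorm_ge0 ?(ltW e0).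
rewrite [X in _ <= _ * X](ger0_norm (enorm_ge0 _)).
case: asboolP => [Cy|_]; last by rewrite normr0.
by rewrite ger0_norm ?le_max ?lexx// ge_max en0 vy.
Qed.

Lemma regular_normal_cone0 m (C : set 'rV[R]_m) z :
  C z -> regular_normal_cone C z 0.
Proof.
move=> Cz; apply/regular_normal_coneP; split=> // e e0.
apply: filterE => y _; rewrite /dotprod big1 => [|j _].
  by rewrite mulr_ge0 ?enorm_ge0 ?(ltW e0).
by rewrite mxE mul0r.
Qed.

Lemma tangent_coneE m (C : set 'rV[R]_m) z u :
  tangent_cone C z u <-> dir_normal_cone C z u 0.
Proof.
split=> [[t [u_ [t0 uu Cu]]]|[t [u_ [v_ [t0 uu _ Nv]]]]].
  exists t, u_, (fun=> 0); split=> // [|k]; first exact: cvg_cst.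
  exact: regular_normal_cone0.
by exists t, u_; split=> // k; case: (Nv k).
Qed.

End Cones.

Unset Implicit Arguments.
Set Strict Implicit.

Section Products.
Context {R : realType} {I : nat} {n : 'I_I -> nat}.
Context (A : forall i : 'I_I, set 'rV[R]_(n i)).
Implicit Types x v : 'rV[R]_(\sum_i n i).

(** Testing a normal of the product on points that differ from [x] in one block only gives the
    estimate for that factor. Conversely, inner products add up over the blocks, and so do the
    estimates, each block being no longer than the whole vector. *)
Lemma regular_normal_cone_mxrow x v :
  regular_normal_cone (set_mxrow A) x v <->
  forall i, regular_normal_cone (A i) (submxrow x i) (submxrow v i).
Proof.
split=> [/regular_normal_coneP[Ax vo] i|Nv]; apply/regular_normal_coneP.
  split=> [|e e0]; first exact: Ax.
  (* [ins y] is [x] with block [i] replaced by [y]. It lies in the product as soon as [y] is in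
     [A i], and [ins y - x] vanishes outside block [i]. *)
  pose ins y := \mxrow_j dfwith (fun j => submxrow x j) i y j.
  have insE y j : submxrow (ins y - x) j =
      dfwith (fun=> 0) i (y - submxrow x i) j.
    rewrite submxrowB mxrowK; case: (eqVneq i j) => [<-|ij].
      by rewrite !dfwithin.
    by rewrite !dfwithout// subrr.
  have dotE u y : dotprod u (ins y - x) =
      dotprod (submxrow u i) (y - submxrow x i).
    rewrite dotprod_submxrow (bigD1 i)//= insE dfwithin big1 ?addr0// => j ji.
    rewrite insE dfwithout 1?eq_sym// /dotprod big1// => k _.
    by rewrite /= [X in _ * X]mxE mulr0.
  have cvg_ins : ins y @[y --> submxrow x i] --> x.
    rewrite -[X in _ --> X]submxrowK.
    apply: (@cvg_mxrow _ _ _ _ (nbhs (submxrow x i)) _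
      (fun j y => dfwith (fun j => submxrow x j) i y j)) => j.
    have [<-|ij] := eqVneq i j.
      by under eq_fun do rewrite dfwithin; exact: cvg_id.
    by under eq_fun do rewrite dfwithout//; exact: cvg_cst.
  have := cvg_ins _ (vo e e0).
  apply: (@filterS _ (nbhs (submxrow x i))) => y /= + Ay.
  (* The second [dotE], with [u := ins y - x], reduces the norm to that of block [i]. *)
  rewrite dotE /enorm dotE [submxrow (ins y - x) i]insE dfwithin; apply => j.
  rewrite mxrowK; have [<-|ij] := eqVneq i j; first by rewrite dfwithin.
  by rewrite dfwithout//; exact: Ax.
split=> [i|e e0]; first by case: (Nv i).
(* The [I] estimates share the tolerance [e]; dividing by [I.+1] avoids a zero denominator when [I]
   is 0. *)
pose c := e / I.+1%:R.
have c0 : 0 < c by rewrite divr_gt0.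
have near_i i : \forall y \near x, A i (submxrow y i) ->
    dotprod (submxrow v i) (submxrow (y - x) i) <= c * enorm (y - x).
  have /regular_normal_coneP[_ /(_ _ c0) vo] := Nv i.
  have := @cvg_submxrow _ _ _ _ (nbhs x) (nbhs_filter x) id x i cvg_id _ vo.
  apply: (@filterS _ (nbhs x)) => y /= vy Ay; rewrite submxrowB.
  by apply: le_trans (vy Ay) _; rewrite ler_pM2l// -submxrowB enorm_submxrow.
have := filter_forall (nbhs_filter x) near_i.
apply: (@filterS _ (nbhs x)) => y vy Ay.
rewrite dotprod_submxrow.
apply: (@le_trans _ _ (\sum_(i < I) c * enorm (y - x))).
  by apply: ler_sum => i _; exact: vy.
rewrite sumr_const card_ord -mulr_natr mulrAC ler_wpM2r ?enorm_ge0//.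
by rewrite /c mulrAC ler_pdivrMr// ler_pM2l// ler_nat.
Qed.

Lemma dir_normal_cone_mxrow x u v :
  dir_normal_cone (set_mxrow A) x u v ->
  forall i, dir_normal_cone (A i) (submxrow x i) (submxrow u i) (submxrow v i).
Proof.
move=> [t [d_ [v_ [t0 du vv Nv]]]] i.
exists t, (fun k => submxrow (d_ k) i), (fun k => submxrow (v_ k) i).
split=> // [||k]; try exact: cvg_submxrow.
have /regular_normal_cone_mxrow /(_ i) := Nv k.
by rewrite submxrowD submxrowZ.
Qed.

Lemma dir_normal_cone_mxrow_regular x u v :
  (forall i j : 'I_I, i != j -> dir_regular (A i) (submxrow x i) \/
    dir_regular (A j) (submxrow x j)) ->
  (forall i, dir_normal_cone (A i) (submxrow x i) (submxrow u i)
    (submxrow v i)) ->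
  dir_normal_cone (set_mxrow A) x u v.
Proof.
move=> reg Nv.
(* Directions and normals are packed into one pair so that a single choice over [i] provides the
   sequences of all factors. *)
pose realized t i := exists dv : (nat -> 'rV[R]_(n i)) * (nat -> 'rV[R]_(n i)),
  [/\ dv.1 @ \oo --> submxrow u i, dv.2 @ \oo --> submxrow v i & forall k,
    regular_normal_cone (A i) (submxrow x i + t k *: dv.1 k) (dv.2 k)].
have inner t i : dir_regular (A i) (submxrow x i) -> pos_cvg0 t -> realized t i.
  move=> Ai t0; have := Nv i; rewrite Ai => /(_ t t0)[d_ [v_ H]].
  by exists (d_, v_).
have [t [t0 /(_ _)/cid H]] : exists t, pos_cvg0 t /\ forall i, realized t i.
  (* A factor that is not regular, if there is one, imposes its own scales, and [reg] makes every
     other factor regular. Otherwise any positive null sequence will do, here [harmonic]. *)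
  have [[i0 Ni0]|allreg] :=
      pselect (exists i, ~ dir_regular (A i) (submxrow x i)).
    have [t [d_ [v_ [t0 du vv Nd]]]] := Nv i0.
    exists t; split=> // i; have [->|ii0] := eqVneq i i0.
      by exists (d_, v_).
    by case: (reg _ _ ii0) => // Ai; exact: inner.
  have h0 : @pos_cvg0 R harmonic.
    by split=> [k|]; [exact: harmonic_gt0|exact: cvg_harmonic].
  exists harmonic; split=> // i; apply: inner => //.
  by apply: contrapT => Ni; apply: allreg; exists i.
have {H}[dv H] := all_sig H.
exists t, (fun k => \mxrow_i (dv i).1 k), (fun k => \mxrow_i (dv i).2 k).
split=> // [||k].
- by rewrite -(submxrowK u); apply: cvg_mxrow => i; case: (H i).
- by rewrite -(submxrowK v); apply: cvg_mxrow => i; case: (H i).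
apply/regular_normal_cone_mxrow => i; have [_ _ /(_ k)] := H i.
by rewrite submxrowD submxrowZ !mxrowK.
Qed.

End Products.

Theorem proposition3p3 (R : realType) (I : nat) (n : 'I_I -> nat)
    (A : forall i : 'I_I, set 'rV[R]_(n i))
    (z d : forall i : 'I_I, 'rV[R]_(n i))
    (zA : forall i : 'I_I, A i (z i)) :
  [/\ tangent_cone (set_mxrow A) (\mxrow_i z i)
        `<=` set_mxrow (fun i => tangent_cone (A i) (z i)),
      dir_normal_cone (set_mxrow A) (\mxrow_i z i) (\mxrow_i d i)
        `<=` set_mxrow (fun i => dir_normal_cone (A i) (z i) (d i)) &
      (forall i j : 'I_I, i != j ->
         dir_regular (A i) (z i) \/ dir_regular (A j) (z j)) ->
      tangent_cone (set_mxrow A) (\mxrow_i z i)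
        = set_mxrow (fun i => tangent_cone (A i) (z i)) /\
      dir_normal_cone (set_mxrow A) (\mxrow_i z i) (\mxrow_i d i)
        = set_mxrow (fun i => dir_normal_cone (A i) (z i) (d i))].
Proof.
(* The direction [u] is left free: it is the concatenation of the [d i] for the normal cones, and
   the candidate tangent vector, with normal 0, for the tangent cones. *)
have subN u : dir_normal_cone (set_mxrow A) (\mxrow_i z i) u
    `<=` set_mxrow (fun i => dir_normal_cone (A i) (z i) (submxrow u i)).
  by move=> v /dir_normal_cone_mxrow Nv i; rewrite -[z i]mxrowK.
have subT : tangent_cone (set_mxrow A) (\mxrow_i z i)
    `<=` set_mxrow (fun i => tangent_cone (A i) (z i)).
  move=> u /tangent_coneE/subN Nu i; apply/tangent_coneE.
  by have := Nu i; rewrite submxrow0.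
have subNd : dir_normal_cone (set_mxrow A) (\mxrow_i z i) (\mxrow_i d i)
    `<=` set_mxrow (fun i => dir_normal_cone (A i) (z i) (d i)).
  by move=> v /subN Nv i; rewrite -[d i]mxrowK.
split=> // reg.
have supN u v : (forall i, dir_normal_cone (A i) (z i) (submxrow u i)
    (submxrow v i)) -> dir_normal_cone (set_mxrow A) (\mxrow_i z i) u v.
  move=> Nv; apply: dir_normal_cone_mxrow_regular => [i j|i].
    by rewrite !mxrowK; exact: reg.
  by rewrite mxrowK.
split; apply/seteqP; split=> // w Nw.
  apply/tangent_coneE/supN => i.
  by rewrite submxrow0; apply/tangent_coneE; exact: Nw.
by apply: supN => i; rewrite mxrowK; exact: Nw.
Qed.
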